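(* Let $p$, $q$ and $k$ be fixed natural numbers such that $p\le q$. For all $n$ such that $pk\le n\le qk$, $$v_{p,q,k}(n)=\left[\begin{matrix}k\\ n-pk\end{matrix}\right]_{q-p+1}.$$ Otherwise either $n<pk$ or $n>qk$, and $v_{p,q,k}(n)=0$. Furthermore, the generating function for $v_{p,q,k}(n)$ is $$\sum_{n=pk}^{qk}v_{p,q,k}(n)x^{n}=x^{pk}\left(1+x+\cdots+x^{q-p}\right)^{k}.$$
   Context: Natural numbers are positive integers, and $n$ ranges over natural numbers. A composition of $n$ into exactly $k$ parts is an ordered sequence $(a_1,\dots,a_k)$ of natural numbers (called its parts) with $n=a_1+a_2+\cdots+a_k$; sequences differing in order are different compositions. $v_{p,q,k}(n)$ denotes the number of compositions of $n$ into exactly $k$ parts, all of whose parts $a$ satisfy $p\le a\le q$. For a natural number $Q$, the symbol $\left[\begin{matrix}k\\ n\end{matrix}\right]_{Q}$ denotes the coefficient of $x^n$ in the expansion of the polynomial $(1+x+\cdots+x^{Q-1})^{k}$, i.e. $$(1+x+\cdots+x^{Q-1})^{k}=\sum_{n=0}^{(Q-1)k}\left[\begin{matrix}k\\ n\end{matrix}\right]_{Q}x^n.$$ *)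

(* Defs.v *)
From mathcomp Require Import all_boot all_order all_algebra.

Set Implicit Arguments.
Unset Strict Implicit.
Unset Printing Implicit Defensive.

Import GRing.Theory.

Local Open Scope nat_scope.

Definition is_composition (n k : nat) (s : seq nat) : bool :=
  [&& size s == k, all (fun a => 0 < a) s & sumn s == n].

(* The parts of a composition of n are at most n, so letting them range over
   'I_n.+1 loses no composition and makes the set being counted finite. *)
Definition bounded_compositions (p q k n : nat) : {set k.-tuple 'I_n.+1} :=
  [set t : k.-tuple 'I_n.+1 |
     is_composition n k [seq val a | a <- t]
     && all (fun a => p <= a <= q) [seq val a | a <- t]].

Definition restricted_comps (p q k n : nat) : nat := #|bounded_compositions p q k n|.

Local Open Scope ring_scope.

Definition geom_poly (Q : nat) : {poly int} := \sum_(i < Q) 'X^i.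

Definition ext_binom (Q k n : nat) : int := (geom_poly Q ^+ k)`_n.

(* Main.v *)
(** The parts of a composition range independently over [p..q], so expanding
    the [k]-th power of [x^p + ... + x^q] and reading off the coefficient of
    [x^n] counts the compositions; this power is
    [x^(p k) (1 + ... + x^(q - p))^k]. *)
Require Import Defs.
From mathcomp Require Import all_boot all_order all_algebra.

Import GRing.Theory.
Local Open Scope ring_scope.

(** A coefficient of degree at most [n] in a product involves only coefficients of degree at most
    [n] in the factors. This allows replacing a base by its truncation. *)
Lemma coef_exp_eq_low (R : nzSemiRingType) (P Q : {poly R}) (n k : nat) :
  (forall i, (i <= n)%N -> P`_i = Q`_i) ->
  forall i, (i <= n)%N -> (P ^+ k)`_i = (Q ^+ k)`_i.
Proof.
move=> eqPQ; elim: k => [|k IHk] i le_in; first by rewrite !expr0.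
rewrite !exprS !coefM; apply: eq_bigr => j _.
rewrite eqPQ ?IHk //; first exact: leq_trans (leq_subr _ _) le_in.
by apply: leq_trans le_in; rewrite -ltnS ltn_ord.
Qed.

Lemma coef_sum_Xn (R : nzSemiRingType) (m : nat) (A : pred nat) (i : nat) :
  (\sum_(a < m | A a) 'X^a : {poly R})`_i = ((i < m)%N && A i)%:R.
Proof.
rewrite coef_sum; under eq_bigr do rewrite coefXn.
case: ltnP => [lt_im | le_mi] /=.
  rewrite big_mkcond (bigD1 (Ordinal lt_im)) //= eqxx big1 ?addr0; first by case: (A i).
  move=> j; rewrite -val_eqE /= eq_sym => /negPf ->.
  by rewrite if_same.
by rewrite big1 // => j _; rewrite gtn_eqF // (leq_trans (ltn_ord j)).
Qed.

(** Distributivity yields one monomial for each choice of [k] exponents satisfying [A], and its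
    degree is the sum of the chosen exponents. *)
Lemma coef_exp_sum_Xn (R : comNzSemiRingType) (m k n : nat) (A : pred nat) :
  ((\sum_(a < m | A a) 'X^a : {poly R}) ^+ k)`_n =
  #|[set t : k.-tuple 'I_m |
      all (fun a : 'I_m => A a) t && (sumn [seq val a | a <- t] == n)]|%:R.
Proof.
rewrite -[in LHS](card_ord k) -prodr_const.
rewrite (eq_bigl xpredT) // (bigA_distr_big _ (fun=> fun a : 'I_m => 'X^a)) /=.
rewrite coef_sum -sum1_card natr_sum.
(* The expansion is indexed by functions from ['I_k] to ['I_m]; these correspond bijectively to
   [k]-tuples. *)
rewrite (reindex (fun t : k.-tuple 'I_m => [ffun i => tnth t i])) /=; last first.
  exists (fun f : {ffun 'I_k -> 'I_m} => [tuple f i | i < k]) => [t _ | f _].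
    by apply: eq_from_tnth => i; rewrite tnth_mktuple ffunE.
  by apply/ffunP => i; rewrite ffunE tnth_mktuple.
rewrite big_mkcond [RHS]big_mkcond; apply: eq_bigr => t _ /=.
have -> : ([ffun i => tnth t i] \in ffun_on (fun a : 'I_m => A a))
          = all (fun a : 'I_m => A a) t.
  by apply/ffun_onP/all_tnthP => H i; move: (H i); rewrite ffunE.
rewrite inE; case: all => //=.
under eq_bigr do rewrite ffunE.
rewrite -expr_sum coefXn eq_sym sumnE big_map big_tuple.
by case: eqP.
Qed.

(** Positivity of the parts follows from [p <= a]; the set thus takes the form counted by
    [coef_exp_sum_Xn]. *)
Lemma bounded_compositionsE (p q k n : nat) : (0 < p)%N ->
  bounded_compositions p q k n =
  [set t : k.-tuple 'I_n.+1 | all (fun a : 'I_n.+1 => p <= a <= q)%N t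
                              && (sumn [seq val a | a <- t] == n)].
Proof.
move=> p_gt0; apply/setP => t; rewrite !inE /is_composition size_map size_tuple.
rewrite eqxx !all_map /= andbC; case: (boolP (all _ t)) => //= /allP Ht.
have -> // : all (preim val (fun a => 0 < a)%N) t.
by apply/allP => a /Ht /andP[/(leq_trans p_gt0)].
Qed.

Lemma restricted_comps_coef (p q k n : nat) : (0 < p)%N -> (p <= q)%N ->
  (restricted_comps p q k n)%:Z = ('X^(p * k) * geom_poly (q - p).+1 ^+ k)`_n.
Proof.
move=> p_gt0 le_pq; rewrite exprM -exprMn.
rewrite /restricted_comps bounded_compositionsE // -natz.
rewrite -(coef_exp_sum_Xn _ _ _ _ (fun a => p <= a <= q)%N).
(* Both sides are now [k]-th powers. The left base stops at degree [n], so the bases may differ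
   above [n] when [q] exceeds [n], but they agree up to [n]. *)
apply: (@coef_exp_eq_low _ _ _ n) => // i le_in.
rewrite (coef_sum_Xn _ _ (fun a => p <= a <= q)%N) ltnS le_in /= coefXnM.
rewrite (coef_sum_Xn _ _ xpredT) andbT ltnS.
by case: ltnP => //= le_pi; rewrite leq_sub2rE.
Qed.

Lemma coef_geom_poly_exp_gt (d k n : nat) : (d * k < n)%N ->
  (geom_poly d.+1 ^+ k)`_n = 0.
Proof.
move=> lt_n; have size_geom : (size (geom_poly d.+1) <= d.+1)%N.
  have -> : geom_poly d.+1 = \poly_(i < d.+1) 1.
    by rewrite poly_def; apply: eq_bigr => i _; rewrite scale1r.
  exact: size_poly.
apply: nth_default; apply: leq_trans (size_poly_exp_leq _ _) _.
by apply: leq_ltn_trans lt_n; rewrite leq_mul2r -subn1 leq_subLR size_geom orbT.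
Qed.

Lemma restricted_comps_eq0 (p q k n : nat) : (0 < p)%N -> (p <= q)%N ->
  ~~ (p * k <= n <= q * k)%N -> restricted_comps p q k n = 0%N.
Proof.
move=> p_gt0 le_pq; rewrite negb_and -!ltnNge => out_n.
apply/eqP; rewrite -eqz_nat restricted_comps_coef // coefXnM.
(* Below [p * k] the factor ['X^(p * k)] gives 0; above [q * k], the index [n - p * k] exceeds the
   degree bound [(q - p) * k]. *)
case: ltnP out_n => //= le_n lt_n; rewrite coef_geom_poly_exp_gt //.
by rewrite mulnBl ltn_sub2rE // leq_mul2r le_pq orbT.
Qed.

Theorem theorem14 (p q k : nat)
    (hp : (0 < p)%N) (hq : (0 < q)%N) (hk : (0 < k)%N) (hpq : (p <= q)%N) :
  (forall n : nat, (0 < n)%N ->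
     ((p * k <= n <= q * k)%N ->
        (restricted_comps p q k n)%:Z = ext_binom (q - p + 1)%N k (n - p * k)%N)
     /\ (~~ (p * k <= n <= q * k)%N ->
        ((n < p * k)%N \/ (q * k < n)%N) /\ restricted_comps p q k n = 0%N))
  /\ \sum_(p * k <= n < (q * k).+1) (restricted_comps p q k n)%:Z *: 'X^n
     = 'X^(p * k) * (\sum_(i < (q - p).+1) 'X^i) ^+ k :> {poly int}.
Proof.
split=> [n _ | ].
  split=> [/andP[le_n _] | out_n].
    by rewrite restricted_comps_coef // coefXnM ltnNge le_n addn1.
  split; last exact: restricted_comps_eq0.
  by move: out_n; rewrite negb_and -!ltnNge => /orP.
apply/polyP => m; rewrite -/(geom_poly _) -restricted_comps_coef // coef_sum.
under eq_bigr do rewrite coefZ coefXn.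
(* In range, only the term of index [m] survives; out of range, no term has degree [m] and the count
   is 0 as well. *)
case: (boolP (p * k <= m <= q * k)%N) => [in_m | out_m].
  rewrite (bigD1_seq m) ?iota_uniq ?mem_index_iota //= eqxx mulr1 big1 ?addr0 //.
  by move=> i /negPf ne_im; rewrite eq_sym ne_im mulr0.
rewrite restricted_comps_eq0 // big_nat big1 // => i in_i.
rewrite [m == i]negbTE ?mulr0 //.
by apply: contraNneq out_m => ->.
Qed.
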